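(* Let $\boldsymbol{x}_{\rm s},\boldsymbol{x}_{\rm d}\in\mathbb{R}^2$, let $\boldsymbol{w}=\frac{\boldsymbol{x}_{\rm s}+\boldsymbol{x}_{\rm d}}{2}$, and let $\widehat{s}(\boldsymbol{x})=\max\{\|\boldsymbol{x}_{\rm s}-\boldsymbol{x}\|,\|\boldsymbol{x}-\boldsymbol{x}_{\rm d}\|\}$. Then $\widehat{s}(\boldsymbol{w})\le\widehat{s}(\boldsymbol{x})$ for all $\boldsymbol{x}\in\mathbb{R}^2$.
   Context: $\|\cdot\|$ is the Euclidean norm on $\mathbb{R}^2$. *)

(* Defs.v *)
From mathcomp Require Import all_boot all_order all_algebra.
From mathcomp Require Import reals.

Set Implicit Arguments.
Unset Strict Implicit.
Unset Printing Implicit Defensive.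

Import Order.TTheory GRing.Theory Num.Theory.
Local Open Scope ring_scope.

(* The norm `|_| that MathComp-Analysis puts on 'rV[R]_n is the sup norm, hence
   this explicit Euclidean norm. *)
Definition enorm (R : realType) (n : nat) (v : 'rV[R]_n) : R :=
  Num.sqrt (\sum_(i < n) v 0 i ^+ 2).

Definition shat (R : realType) (xs xd x : 'rV[R]_2) : R :=
  Num.max (enorm (xs - x)) (enorm (x - xd)).

(* Main.v *)
(* Both endpoints differ from the midpoint by the average of [xs - x] and
   [x - xd], and the norm of an average is at most the larger norm. *)
Require Import Defs.
From mathcomp Require Import all_boot all_order all_algebra.
From mathcomp Require Import reals.
From mathcomp Require Import lra.

Set Implicit Arguments.
Unset Strict Implicit.
Unset Printing Implicit Defensive.

Import Order.TTheory GRing.Theory Num.Theory.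
Local Open Scope ring_scope.

(** Both [xs - w] and [w - xd] are half of [xs - xd], in which any [x] can be inserted.
    [enorm_avg_le_max] then concludes, by convexity of the square in each coordinate. *)

Lemma enorm_avg_le_max (R : realType) (n : nat) (u v : 'rV[R]_n) :
  enorm (2^-1 *: (u + v)) <= Num.max (enorm u) (enorm v).
Proof.
have avg_sq : \sum_(i < n) (2^-1 *: (u + v)) 0 i ^+ 2 <=
    2^-1 * (\sum_(i < n) u 0 i ^+ 2 + \sum_(i < n) v 0 i ^+ 2).
  rewrite -big_split mulr_sumr; apply: ler_sum => i _; rewrite !mxE /=.
  (* The right side exceeds the left by a quarter of this square. *)
  have := sqr_ge0 (u 0 i - v 0 i); nra.
rewrite /enorm le_max.
(* The mean of the two sums is at most the larger one, which selects the disjunct. *)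
have [le_uv|lt_vu] := leP (\sum_(i < n) u 0 i ^+ 2) (\sum_(i < n) v 0 i ^+ 2);
  apply/orP; [right|left]; apply: ler_wsqrtr; lra.
Qed.

Theorem lemma2 (R : realType) (xs xd : 'rV[R]_2) :
  let w : 'rV[R]_2 := 2^-1 *: (xs + xd) in
  forall x : 'rV[R]_2, shat xs xd w <= shat xs xd x.
Proof.
move=> w x.
have sub_sw : xs - w = 2^-1 *: ((xs - x) + (x - xd)).
  by apply/rowP => i; rewrite !mxE; lra.
have sub_wd : w - xd = 2^-1 *: ((xs - x) + (x - xd)).
  by apply/rowP => i; rewrite !mxE; lra.
by rewrite /shat sub_sw sub_wd maxxx enorm_avg_le_max.
Qed.
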